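(* Let $\alpha=(\alpha_n)_{n=1}^\infty$ be any sequence of positive real numbers such that $\alpha$ is unbounded but does not diverge to $\infty$. Then $A_\alpha$ is a strong Ditkin algebra which does not have bounded relative units in the sense of Dales.
   Context: $\mathbb{N}=\{1,2,3,\dots\}$, and $\mathbb{N}_\infty=\mathbb{N}\cup\{\infty\}$ is the one point compactification of $\mathbb{N}$. $C(\mathbb{N}_\infty)$ is the algebra of continuous complex-valued functions on $\mathbb{N}_\infty$, with uniform norm $\|f\|_\infty=\sup\{|f(n)|:n\in\mathbb{N}\}$. For a sequence $\alpha=(\alpha_n)_{n=1}^\infty$ of positive real numbers, $$A_\alpha=\left\{f\in C(\mathbb{N}_\infty):\sum_{n=1}^\infty \alpha_n|f(n+1)-f(n)|<\infty\right\},$$ with norm $\|f\|=\|f\|_\infty+\sum_{n=1}^\infty\alpha_n|f(n+1)-f(n)|$. A Banach function algebra on a compact Hausdorff space $X$ is a subalgebra of $C(X)$ containing the constants and separating the points of $X$, with a complete algebra norm. $A_\alpha$ is a Banach function algebra on $\mathbb{N}_\infty$, and its character space is $\mathbb{N}_\infty$ (every character is evaluation at a point of $\mathbb{N}_\infty$). Let $A$ be a unital Banach function algebra, regarded as an algebra of functions on its character space $\Phi_A$. For $\phi\in\Phi_A$, $M_\phi=\{f\in A: f(\phi)=0\}$ and $J_\phi=\{f\in A: f \text{ vanishes on some neighbourhood of } \phi\}$. $A$ is strongly regular if $J_\phi$ is dense in $M_\phi$ for every $\phi\in\Phi_A$. $A$ is a strong Ditkin algebra if it is strongly regular and every maximal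 ideal of $A$ has a bounded approximate identity. $A$ has bounded relative units in the sense of Dales if there is a constant $C\ge 1$ such that for every $\phi\in\Phi_A$ and every compact set $E\subseteq\Phi_A\setminus\{\phi\}$ there is $f\in J_\phi$ with $\|f\|\le C$ and $f(E)\subseteq\{1\}$. *)

(* Defs.v *)
From mathcomp Require Import all_boot all_order all_algebra.
From mathcomp Require Import all_classical all_reals all_analysis.
From mathcomp Require Import complex.
Set Implicit Arguments.
Unset Strict Implicit.
Unset Printing Implicit Defensive.
Import Order.TTheory GRing.Theory Num.Theory.
Import numFieldNormedType.Exports.
Local Open Scope classical_set_scope.
Local Open Scope ring_scope.
Local Open Scope complex_scope.

(* [Normc.normc z : R] is the modulus; the generic norm [`|z|] of z : R[i] is
   again an element of R[i].  [R[i]^o] is [R[i]] seen as a normed module over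
   itself: this alias is what carries the usual topology.  A normed algebra
   of functions is given by its carrier [A : set (T -> R[i])] and a function
   [N] that is only meaningful on [A]. *)
Section BanachFunctionAlgebras.
Context {R : realType} {T : topologicalType}.
Implicit Types (A I : set (T -> R[i])) (N : (T -> R[i]) -> R).

Definition subalgebra_with_constants A :=
  [/\ forall c : R[i], A (cst c),
      forall f g, A f -> A g -> A (f \+ g),
      forall (c : R[i]) f, A f -> A (c \*o f) &
      forall f g, A f -> A g -> A (f \* g)].

Definition separates_points A :=
  forall x y : T, x <> y -> exists2 f, A f & f x <> f y.

Definition algebra_norm A N :=
  [/\ forall f, A f -> 0 <= N f,
      forall f, A f -> N f = 0 -> f = cst 0,
      forall (c : R[i]) f, A f -> N (c \*o f) = Normc.normc c * N f,
      forall f g, A f -> A g -> N (f \+ g) <= N f + N g &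
      forall f g, A f -> A g -> N (f \* g) <= N f * N g].

Definition complete_norm A N :=
  forall u : nat -> T -> R[i], (forall n, A (u n)) ->
    (forall e : R, 0 < e -> exists n0 : nat, forall m n : nat,
       (n0 <= m)%N -> (n0 <= n)%N -> N (u m \- u n) < e) ->
    exists2 f, A f & N (u n \- f) @[n --> \oo] --> (0 : R).

Definition banach_function_algebra A N :=
  [/\ compact [set: T] /\ hausdorff_space T,
      forall f, A f -> continuous (f : T -> R[i]^o),
      subalgebra_with_constants A,
      separates_points A &
      algebra_norm A N /\ complete_norm A N].

(* Characters are nonzero linear multiplicative functionals on the type of
   elements of [A]; [{ptws A -> R[i]^o}] carries the topology of pointwise
   convergence, so that [character_space A] with its relative topology is the
   character space with the Gelfand topology, and [f : A] is regarded as the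
   function [phi |-> phi f] on it. *)
Definition character_space A : set {ptws A -> R[i]^o} :=
  [set phi | [/\ forall (a b : R[i]) (f g h : A),
                   val h = (a \*o val f) \+ (b \*o val g) ->
                   phi h = a * phi f + b * phi g,
                 forall f g h : A,
                   val h = val f \* val g -> phi h = phi f * phi g &
                 exists f : A, phi f <> 0]].

Definition M_ A (phi : {ptws A -> R[i]^o}) : set A := [set f : A | phi f = 0].

Definition J_ A (phi : {ptws A -> R[i]^o}) : set A :=
  [set f : A | \forall psi \near within (@character_space A) (nbhs phi),
                 psi f = 0].

Definition strongly_regular A N :=
  forall phi, @character_space A phi ->
  forall f : A, M_ phi f ->
  forall e : R, 0 < e -> exists2 g : A, J_ phi g & N (val f \- val g) < e.

Definition ideal A I :=
  [/\ I `<=` A,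
      I (cst 0),
      forall f g, I f -> I g -> I (f \+ g) &
      forall f g, A f -> I g -> I (f \* g)].

Definition maximal_ideal A I :=
  [/\ ideal A I, I <> A &
      forall K, ideal A K -> I `<=` K -> K = I \/ K = A].

Definition directed (D : Type) (le : D -> D -> Prop) :=
  [/\ inhabited D,
      forall x, le x x,
      forall x y z, le x y -> le y z -> le x z &
      forall x y, exists z, le x z /\ le y z].

Definition has_bounded_approximate_identity N I :=
  exists (D : Type) (le : D -> D -> Prop) (e : D -> T -> R[i]),
    [/\ directed le,
        forall d, I (e d),
        exists K : R, forall d, N (e d) <= K &
        forall f, I f -> forall eps : R, 0 < eps ->
          exists d0, forall d, le d0 d -> N ((e d \* f) \- f) < eps].

Definition strong_Ditkin_algebra A N :=
  [/\ banach_function_algebra A N,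
      strongly_regular A N &
      forall I, maximal_ideal A I -> has_bounded_approximate_identity N I].

Definition bounded_relative_units A N :=
  exists2 C : R, 1 <= C &
    forall phi, @character_space A phi ->
    forall E : set {ptws A -> R[i]^o},
      compact E -> E `<=` @character_space A `\ phi ->
      exists f : A, [/\ J_ phi f, N (val f) <= C &
                        forall psi, E psi -> psi f = 1].

End BanachFunctionAlgebras.

Notation N_oo := (one_point_compactification nat).

(* Indices are shifted by one: the natural number [n] of Rocq stands for the
   positive integer n + 1, so [alpha n] is alpha_{n+1}; [None] is the point at
   infinity. *)
Section Aalpha.
Context {R : realType}.
Implicit Types (alpha : nat -> R) (f : N_oo -> R[i]).

Definition weighted_variation alpha f : \bar R :=
  (\sum_(n <oo)
     (alpha n * Normc.normc (f (Some n.+1) - f (Some n)))%:E)%E.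

Definition A_ alpha : set (N_oo -> R[i]) :=
  [set f | continuous (f : N_oo -> R[i]^o) /\ (weighted_variation alpha f < +oo)%E].

Definition uniform_norm f : R :=
  sup (range (fun n : nat => Normc.normc (f (Some n)))).

Definition A_norm alpha f : R :=
  uniform_norm f + fine (weighted_variation alpha f).

End Aalpha.

(* Main.v *)
Require Import Defs.
From mathcomp Require Import all_boot all_order all_algebra.
From mathcomp Require Import all_classical all_reals all_analysis.
From mathcomp Require Import complex.
From mathcomp Require Import ring lra.
Import Order.TTheory GRing.Theory Num.Theory.
Import numFieldNormedType.Exports.
Local Open Scope classical_set_scope.
Local Open Scope ring_scope.

(** The weights [alpha] do not tend to infinity, so they stay below some [M]
    along infinitely many indices [N].  Cutting a function that vanishes at
    infinity off after such an [N] creates a single jump, of cost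
    [alpha N * |f N.+1| <= M * |f N.+1|], on top of a tail of the variation of
    [f]; both tend to [0].  Hence functions vanishing near infinity are dense
    in the maximal ideal at infinity, and the indicators of the segments
    [0 .. N] form an approximate identity there, bounded by [1 + M]
    ([A_norm_head_approx], [A_norm_head_le]).  At a finite point nothing has to
    be approximated: the point is isolated, and the indicator of its complement
    is an identity of the maximal ideal.

    These facts speak of the points of [N_oo], whereas the theorem speaks of
    abstract characters and abstract maximal ideals.  The bridge is
    [proper_ideal_common_zero]: all members of a proper ideal vanish at a
    common point.  If not, the ideal contains the indicator of each finite
    point, hence of each initial segment, and a function that is nonzero near
    infinity; their combination is bounded away from [0], and such functions
    are invertible in the algebra ([A_V]).  This makes maximal ideals the
    zero ideals of points ([maximal_idealE]) and, applied to kernels, makes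
    characters evaluations ([characterE]).  That a function belongs to
    [J_ phi] is seen on idempotents: characters take only the values [0] and
    [1] there, so being close to [phi] at an idempotent means agreeing with
    [phi] on it ([J_idempotent]).

    Bounded relative units fail at finite points.  A function that is [0] at
    [m] and [1] at [m.+1] has a jump of cost [alpha m], so a constant [C] for
    bounded relative units bounds [alpha] ([bounded_relative_units_le]). *)

Set Implicit Arguments.
Unset Strict Implicit.

(** * The modulus of complex numbers and convergence *)

Local Notation normc := Normc.normc.

Section Modulus.
Context {R : realType}.
Implicit Types x y z : R[i].

Lemma normrE x : `|x| = (normc x)%:C%C.
Proof. by rewrite normc_def; case: x. Qed.

Lemma normc_ge0 x : 0 <= normc x.
Proof. by case: x => a b; exact: sqrtr_ge0. Qed.

Lemma normcD x y : normc (x + y) <= normc x + normc y.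
Proof. exact: le_normcD. Qed.

Lemma normc_opp x : normc (- x) = normc x.
Proof. exact: normcN. Qed.

Lemma normcC x y : normc (x - y) = normc (y - x).
Proof. by rewrite -normc_opp opprB. Qed.

Lemma normc_dist3 y x z : normc (x - z) <= normc (x - y) + normc (y - z).
Proof. by rewrite (le_trans _ (normcD _ _))// addrA subrK. Qed.

Lemma normc_ReIm x : normc x <= `|complex.Re x| + `|complex.Im x|.
Proof.
case: x => a b /=; rewrite -[leRHS]ger0_norm ?addr_ge0// -sqrtr_sqr.
by rewrite ler_wsqrtr// sqrrD !real_normK ?num_real// addrAC lerDl mulrn_wge0 ?mulr_ge0.
Qed.

Lemma Re_le_normc x : `|complex.Re x| <= normc x.
Proof. by case: x => a b /=; rewrite -sqrtr_sqr ler_wsqrtr// lerDl sqr_ge0. Qed.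

Lemma Im_le_normc x : `|complex.Im x| <= normc x.
Proof. by case: x => a b /=; rewrite -sqrtr_sqr ler_wsqrtr// lerDr sqr_ge0. Qed.

Lemma normc_eq0 x : (normc x == 0) = (x == 0).
Proof.
apply/eqP/eqP => [/Normc.eq0_normc//|->]; exact: Normc.normc0.
Qed.

(** The generic criterion quantifies over the positive elements of [R[i]],
    which are the positive reals. *)
Lemma cvg_normcP (T : Type) (F : set_system T) (FF : Filter F)
    (f : T -> R[i]^o) (l : R[i]^o) :
  f x @[x --> F] --> l <->
  forall e : R, 0 < e -> \forall x \near F, normc (l - f x) < e.
Proof.
split => [/cvgrPdist_lt cf e e0|cf].
  have e0' : 0 < (e%:C%C : R[i]) by rewrite ltcR.
  by apply: filterS (cf _ e0') => x; rewrite normrE ltcR.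
apply/cvgrPdist_lt => -[a b] /[dup] ab0.
rewrite ltcE /= => /andP[/eqP b0 a0].
by apply: filterS (cf _ a0) => x; rewrite normrE ltcE /= b0 eqxx.
Qed.

Lemma cauchy_normc_cvg (v : nat -> R[i]) :
  (forall e : R, 0 < e -> exists n0 : nat, forall m n : nat,
     (n0 <= m)%N -> (n0 <= n)%N -> normc (v m - v n) < e) ->
  exists l, forall e : R, 0 < e -> exists n0 : nat, forall n : nat,
     (n0 <= n)%N -> normc (v n - l) < e.
Proof.
move=> cv.
have real_cvg (p : R[i] -> R) : (forall x y, p (x - y) = p x - p y) ->
    (forall x, `|p x| <= normc x) -> cvgn (p \o v).
  move=> pB ple; apply/cauchy_cvgP/cauchy_exP => e e0.
  have [n0 vn0] := cv _ e0.
  exists (p (v n0)); exists n0 => // n /= n0n.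
  rewrite -ball_normE /ball_/= -pB (le_lt_trans (ple _))//.
  exact: vn0.
have /cvgrPdist_lt cvR := real_cvg (@complex.Re R) (fun x y => raddfB _ x y) Re_le_normc.
have /cvgrPdist_lt cvI := real_cvg (@complex.Im R) (fun x y => raddfB _ x y) Im_le_normc.
exists ((limn (@complex.Re R \o v)) +i* (limn (@complex.Im R \o v)))%C => e e0.
have e2 : 0 < e / 2 by rewrite divr_gt0.
have [n1 _ vn1] := cvR _ e2; have [n2 _ vn2] := cvI _ e2.
exists (maxn n1 n2) => n; rewrite geq_max => /andP[n1n n2n].
rewrite normcC (le_lt_trans (normc_ReIm _))// [e]splitr ltrD//.
  by have := vn1 _ n1n; rewrite /= ; case: (v n).
by have := vn2 _ n2n; rewrite /= ; case: (v n).
Qed.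

End Modulus.

(** * The topology of the one-point compactification *)

Section OnePointCompactification.

Lemma nbhs_SomeP (n : nat) (U : set N_oo) : nbhs (Some n : N_oo) U <-> U (Some n).
Proof.
split; first exact: nbhs_singleton.
move=> Un; change (nbhs n (Some @^-1` U)).
by rewrite nbhs_principalE; exact/principal_filterP.
Qed.

(** The compact subsets of [nat] are the bounded ones: near infinity, every [n]
    exceeds each point of a compact set, uniformly. *)
Lemma nbhs_NoneP (U : set N_oo) :
  nbhs (None : N_oo) U <-> U None /\ \forall n \near \oo, U (Some n).
Proof.
split=> [UN|[UN [N _ NU]]].
  split; first exact: nbhs_singleton UN.
  case: UN => K [/compact_near_coveringP cK _] KU.
  have /cK : forall x, K x -> \forall y \near x & n \near \oo, (y < n)%N.
    move=> x _; exists ([set x], [set n | (x < n)%N]) => /=.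
      by split; [rewrite nbhs_principalE; exact/principal_filterP|exists x.+1].
    by move=> [y n] /= [->].
  apply: filterS => n Kn; apply: KU; left; exists n => // /Kn.
  by rewrite ltnn.
exists `I_N.
  split; last exact: discrete_closed.
  by apply: finite_compact; exact: finite_II.
move=> x [[n /= /negP]|->//]; rewrite -leqNgt => Nn <-; exact: NU.
Qed.

Lemma N_oo_hausdorff : hausdorff_space N_oo.
Proof.
have sep n (x : N_oo) : x <> Some n -> ~ cluster (nbhs (Some n : N_oo)) x.
  move=> xn cl; have [] := cl [set Some n] (~` [set Some n]).
  - exact/nbhs_SomeP.
  - case: x xn cl => [m|] xn _; first exact/nbhs_SomeP.
    apply/nbhs_NoneP; split=> //; exists n.+1 => // m /= nm [mn].
    by rewrite mn ltnn in nm.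
  - by move=> y [].
move=> [n|] [m|] // cl; apply: contrapT => nm.
- exact: (sep n (Some m)) (nm \o esym) cl.
- exact: (sep n None) _ cl.
- apply: (sep m None) => // A B nA nB; rewrite setIC; exact: cl.
Qed.

Context {R : realType}.

Definition cvg_at_infty (f : N_oo -> R[i]) :=
  forall e : R, 0 < e -> exists N : nat, forall n : nat,
    (N <= n)%N -> normc (f (Some n) - f None) < e.

Lemma continuous_N_ooP (f : N_oo -> R[i]) :
  continuous (f : N_oo -> R[i]^o) <-> cvg_at_infty f.
Proof.
split=> [cf e e0|cf [n|]].
- have /(cvg_normcP (nbhs_filter _))/(_ _ e0) := cf None.
  by move=> /nbhs_NoneP[_ [N _ NU]]; exists N => n Nn; rewrite normcC; exact: NU.
- by move=> U /= /nbhs_singleton Un; exact/nbhs_SomeP.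
- apply/(cvg_normcP (nbhs_filter (None : N_oo))) => e e0; apply/nbhs_NoneP; split.
    by rewrite subrr Normc.normc0.
  by have [N Nf] := cf _ e0; exists N => // n Nn; rewrite normcC; exact: Nf.
Qed.

End OnePointCompactification.

(** * The algebra, its norm and its inverses through partial variations *)

Section PartialVariations.
Context {R : realType}.
Variable alpha : nat -> R.
Hypothesis alpha_gt0 : forall n, 0 < alpha n.
Implicit Types f g : N_oo -> R[i].

Definition variation_term f (i : nat) : R :=
  alpha i * normc (f (Some i.+1) - f (Some i)).

Definition partial_variation f n : R := \sum_(0 <= i < n) variation_term f i.

Lemma variation_term_ge0 f i : 0 <= variation_term f i.
Proof. by rewrite mulr_ge0 ?normc_ge0 ?ltW. Qed.

Lemma partial_variation_le_weighted f n :
  ((partial_variation f n)%:E <= weighted_variation alpha f)%E.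
Proof.
rewrite /partial_variation -sumEFin.
apply: nneseries_lim_ge => i _ _; rewrite lee_fin; exact: variation_term_ge0.
Qed.

Lemma weighted_variation_le f (K : R) :
  (forall n, partial_variation f n <= K) ->
  (weighted_variation alpha f <= K%:E)%E.
Proof.
move=> fK; apply: lime_le.
  by apply: is_cvg_nneseries => i _ _; rewrite lee_fin; exact: variation_term_ge0.
apply: nearW => n; rewrite sumEFin lee_fin; exact: fK.
Qed.

Lemma weighted_variation_fin f : A_ alpha f ->
  weighted_variation alpha f = (fine (weighted_variation alpha f))%:E.
Proof.
move=> [_ Vf]; rewrite fineK// ge0_fin_numE//.
apply: le_trans (partial_variation_le_weighted f 0).
by rewrite lee_fin /partial_variation big_nil.
Qed.

(** Stated with real partial sums, membership can be checked without computing
    any sum of an extended real series. *)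
Lemma A_P f : A_ alpha f <->
  cvg_at_infty f /\ exists K, forall n, partial_variation f n <= K.
Proof.
split=> [Af|[/continuous_N_ooP cf [K fK]]]; split=> //.
- by apply/continuous_N_ooP; case: Af.
- exists (fine (weighted_variation alpha f)) => n.
  rewrite -lee_fin -weighted_variation_fin//.
  exact: partial_variation_le_weighted.
- by rewrite (le_lt_trans (weighted_variation_le fK))// ltry.
Qed.

Lemma cvg_at_infty_bounded f : cvg_at_infty f ->
  exists B, forall n, normc (f (Some n)) <= B.
Proof.
move=> /(_ 1 ltr01)[N fN].
exists ((1 + normc (f None)) + \sum_(0 <= i < N) normc (f (Some i))) => n.
have [Nn|nN] := leqP N n.
  rewrite ler_wpDr ?sumr_ge0// => [i _|]; first exact: normc_ge0.
  rewrite -[f (Some n)](subrK (f None)) (le_trans (normcD _ _))// lerD2r ltW//.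
  exact: fN.
rewrite ler_wpDl ?addr_ge0 ?normc_ge0// big_mkord (bigD1 (Ordinal nN))//= lerDl.
by rewrite sumr_ge0// => i _; exact: normc_ge0.
Qed.

(** The uniform norm ignores the point at infinity; by continuity nothing is
    lost. *)
Lemma normc_infty_le f (B : R) : cvg_at_infty f ->
  (forall n, normc (f (Some n)) <= B) -> normc (f None) <= B.
Proof.
move=> cf fB; apply/ler_addgt0Pr => e e0; have [N fN] := cf e e0.
rewrite -[f None](subrK (f (Some N))) (le_trans (normcD _ _))// addrC lerD//.
by rewrite normcC ltW// fN.
Qed.

Lemma A_norm_le f (a b : R) : A_ alpha f ->
  (forall n, normc (f (Some n)) <= a) ->
  (forall n, partial_variation f n <= b) -> A_norm alpha f <= a + b.
Proof.
move=> Af fa fb; rewrite lerD//.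
  apply: ge_sup; first by exists (normc (f (Some 0%N))); exists 0%N.
  by move=> _ [n _ <-].
by rewrite -lee_fin -weighted_variation_fin//; exact: weighted_variation_le.
Qed.

Lemma normc_le_uniform f x : A_ alpha f -> normc (f x) <= uniform_norm f.
Proof.
move=> /A_P[cf _].
have fle n : normc (f (Some n)) <= uniform_norm f.
  have [B fB] := cvg_at_infty_bounded cf.
  apply: ub_le_sup; last by exists n.
  by exists B => _ [m _ <-].
by case: x => [n//|]; exact: normc_infty_le.
Qed.

Lemma partial_variation_le_fine f n : A_ alpha f ->
  partial_variation f n <= fine (weighted_variation alpha f).
Proof.
move=> Af; rewrite -lee_fin -weighted_variation_fin//.
exact: partial_variation_le_weighted.
Qed.

Lemma uniform_norm_ge0 f : A_ alpha f -> 0 <= uniform_norm f.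
Proof. by move=> /(normc_le_uniform None); apply: le_trans; exact: normc_ge0. Qed.

Lemma fine_variation_ge0 f : A_ alpha f -> 0 <= fine (weighted_variation alpha f).
Proof.
by move=> /(@partial_variation_le_fine f 0); rewrite /partial_variation big_nil.
Qed.

Lemma normc_le_A_norm f x : A_ alpha f -> normc (f x) <= A_norm alpha f.
Proof.
move=> Af; rewrite (le_trans (normc_le_uniform x Af))// lerDl.
exact: fine_variation_ge0.
Qed.

Lemma partial_variation_le_A_norm f n : A_ alpha f ->
  partial_variation f n <= A_norm alpha f.
Proof.
move=> Af; rewrite (le_trans (partial_variation_le_fine n Af))// lerDr.
exact: uniform_norm_ge0.
Qed.

Lemma variation_term_le_A_norm f i : A_ alpha f ->
  variation_term f i <= A_norm alpha f.
Proof.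
move=> /(@partial_variation_le_A_norm f i.+1); apply: le_trans.
rewrite /partial_variation big_nat_recr//= lerDr sumr_ge0// => j _.
exact: variation_term_ge0.
Qed.

(** Sums, products and inverses all have jumps dominated by those of their
    arguments; this turns such a domination into a bound on variations. *)
Lemma partial_variation_le_sum f g h (a b : R) n :
  (forall i, normc (h (Some i.+1) - h (Some i)) <=
     a * normc (f (Some i.+1) - f (Some i)) +
     b * normc (g (Some i.+1) - g (Some i))) ->
  partial_variation h n <= a * partial_variation f n + b * partial_variation g n.
Proof.
move=> hfg; rewrite /partial_variation !mulr_sumr -big_split/= ler_sum// => i _.
rewrite /variation_term (le_trans (ler_wpM2l (ltW (alpha_gt0 i)) (hfg i)))//.
by rewrite mulrDr !(mulrCA _ (alpha i)).
Qed.

Lemma partial_variationD f g n :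
  partial_variation (f \+ g) n <= partial_variation f n + partial_variation g n.
Proof.
rewrite -[leRHS]mul1r mulrDr; apply: partial_variation_le_sum => i /=.
by rewrite !mul1r opprD addrACA; exact: normcD.
Qed.

Lemma partial_variationZ (c : R[i]) f n :
  partial_variation (c \*o f) n = normc c * partial_variation f n.
Proof.
rewrite /partial_variation mulr_sumr; apply: eq_bigr => i _.
by rewrite /variation_term /= -mulrBr Normc.normcM mulrCA.
Qed.

Lemma partial_variationM f g n (a b : R) :
  (forall i, normc (f (Some i)) <= a) -> (forall i, normc (g (Some i)) <= b) ->
  partial_variation (f \* g) n <=
    b * partial_variation f n + a * partial_variation g n.
Proof.
move=> fa gb; apply: partial_variation_le_sum => i /=.
have -> : f (Some i.+1) * g (Some i.+1) - f (Some i) * g (Some i) =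
    g (Some i.+1) * (f (Some i.+1) - f (Some i)) +
    f (Some i) * (g (Some i.+1) - g (Some i)) by ring.
by rewrite (le_trans (normcD _ _))// !Normc.normcM lerD// ler_wpM2r ?normc_ge0.
Qed.

Lemma A_D f g : A_ alpha f -> A_ alpha g -> A_ alpha (f \+ g).
Proof.
move=> [cf Vf] [cg Vg].
have /A_P[_ [K fK]] : A_ alpha f by [].
have /A_P[_ [L gL]] : A_ alpha g by [].
apply/A_P; split.
  by apply/continuous_N_ooP => x; apply: (@continuousD R[i] R[i]^o);
    [exact: cf|exact: cg].
by exists (K + L) => n; rewrite (le_trans (partial_variationD _ _ _))// lerD.
Qed.

Lemma A_M f g : A_ alpha f -> A_ alpha g -> A_ alpha (f \* g).
Proof.
move=> Af Ag; have [cf _] := Af; have [cg _] := Ag.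
apply/A_P; split.
  by apply/continuous_N_ooP => x; apply: (@continuousM R[i]); [exact: cf|exact: cg].
exists (uniform_norm g * fine (weighted_variation alpha f) +
        uniform_norm f * fine (weighted_variation alpha g)) => n.
have fn i := normc_le_uniform (Some i) Af.
have gn i := normc_le_uniform (Some i) Ag.
rewrite (le_trans (partial_variationM _ fn gn))// lerD// ler_wpM2l//;
  by [exact: uniform_norm_ge0|exact: partial_variation_le_fine].
Qed.

(** Only finitely many jumps are nonzero, whatever the weights; this provides
    all the indicators that occur below. *)
Lemma A_eventually_cst f N :
  (forall n, (N <= n)%N -> f (Some n) = f None) -> A_ alpha f.
Proof.
move=> fN; apply/A_P; split.
  by move=> e e0; exists N => n Nn; rewrite fN// subrr Normc.normc0.
exists (partial_variation f N) => n.
have [nN|/ltnW Nn] := leqP n N.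
  rewrite /partial_variation [leRHS](big_cat_nat (leq0n n) nN)//= lerDl sumr_ge0// => i _.
  exact: variation_term_ge0.
rewrite /partial_variation (big_cat_nat (leq0n N) Nn)//= gerDl big_nat_cond big1// => i.
rewrite andbT => /andP[Ni _].
by rewrite /variation_term !fN ?(leqW Ni)// subrr Normc.normc0 mulr0.
Qed.

Lemma A_cst (c : R[i]) : A_ alpha (cst c).
Proof. exact: (@A_eventually_cst _ 0). Qed.

Lemma A_Z (c : R[i]) f : A_ alpha f -> A_ alpha (c \*o f).
Proof. by move=> Af; exact: A_M (A_cst c) Af. Qed.

Lemma A_B f g : A_ alpha f -> A_ alpha g -> A_ alpha (f \- g).
Proof.
move=> Af Ag; rewrite (_ : f \- g = f \+ (-1 \*o g)); last first.
  by apply/funext => x /=; rewrite mulN1r.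
exact: A_D Af (A_Z _ Ag).
Qed.

(** With [d] a lower bound for [|f|], the map [z |-> z^-1] is Lipschitz with
    constant [d ^- 2] on the range of [f]. *)
Lemma A_V f (d : R) : 0 < d -> (forall x, d <= normc (f x)) ->
  A_ alpha f -> A_ alpha (fun x => (f x)^-1).
Proof.
move=> d0 df /A_P[cf [K fK]].
have f0 x : f x != 0 by rewrite -normc_eq0 gt_eqF// (lt_le_trans d0).
have fVB x y : normc ((f x)^-1 - (f y)^-1) <= d ^- 2 * normc (f x - f y).
  have -> : (f x)^-1 - (f y)^-1 = (f x)^-1 * (f y)^-1 * - (f x - f y).
    by field; rewrite !f0.
  rewrite !Normc.normcM normc_opp !Normc.normcV ler_wpM2r ?normc_ge0//.
  rewrite expr2 invfM ler_pM ?invr_ge0 ?normc_ge0//;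
  by rewrite lef_pV2 ?posrE ?df// (lt_le_trans d0).
apply/A_P; split.
  move=> e e0; have [|N fN] := cf (d ^+ 2 * e); first by rewrite mulr_gt0 ?exprn_gt0.
  exists N => n Nn; rewrite (le_lt_trans (fVB _ _))// mulrC ltr_pdivrMr ?exprn_gt0//.
  by rewrite mulrC fN.
exists (d ^- 2 * K) => n.
rewrite (@le_trans _ _ (d ^- 2 * partial_variation f n + 0 * partial_variation f n))//.
  by apply: partial_variation_le_sum => i; rewrite mul0r addr0.
by rewrite mul0r addr0 ler_wpM2l// invr_ge0 exprn_ge0// ltW.
Qed.

End PartialVariations.

(** * The Banach function algebra *)

Section BanachAlgebra.
Context {R : realType}.
Variable alpha : nat -> R.
Hypothesis alpha_gt0 : forall n, 0 < alpha n.
Implicit Types f g : N_oo -> R[i].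
Let A_normc_le := normc_le_uniform alpha_gt0.
Let A_pvar_le := partial_variation_le_fine alpha_gt0.

Lemma A_normZ_le (c : R[i]) f : A_ alpha f ->
  A_norm alpha (c \*o f) <= normc c * A_norm alpha f.
Proof.
move=> Af; rewrite mulrDr; apply: (A_norm_le alpha_gt0) => [|n|n].
- exact: A_Z.
- by rewrite /= Normc.normcM ler_wpM2l ?normc_ge0// A_normc_le.
- by rewrite partial_variationZ ler_wpM2l ?normc_ge0// A_pvar_le.
Qed.

Lemma A_norm_ge0 f : A_ alpha f -> 0 <= A_norm alpha f.
Proof. by move=> /(normc_le_A_norm alpha_gt0 None); apply: le_trans; exact: normc_ge0. Qed.

Lemma A_algebra_norm : algebra_norm (A_ alpha) (A_norm alpha).
Proof.
split.
- exact: A_norm_ge0.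
- move=> f Af Nf0; apply/funext => x; apply/eqP; rewrite -normc_eq0.
  by rewrite eq_le normc_ge0 andbT -Nf0 (normc_le_A_norm alpha_gt0).
- move=> c f Af; apply/eqP; rewrite eq_le A_normZ_le//=.
  have [->|c0] := eqVneq c 0.
    by rewrite Normc.normc0 mul0r A_norm_ge0//; exact: A_Z.
  have {1}-> : f = c^-1 \*o (c \*o f).
    by apply/funext => x /=; rewrite mulrA mulVf// mul1r.
  have nc0 : 0 < normc c by rewrite lt_def normc_ge0 normc_eq0 c0.
  (* The reverse inequality is the direct one for the scalar [c^-1]. *)
  rewrite -ler_pdivlMl// -Normc.normcV; apply: A_normZ_le; exact: A_Z.
- move=> f g Af Ag; rewrite /A_norm addrACA.
  apply: (A_norm_le alpha_gt0) => [|n|n].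
  + exact: A_D.
  + by apply: le_trans (normcD _ _) _; rewrite lerD// A_normc_le.
  + by rewrite (le_trans (partial_variationD _ _ _ _))// lerD// A_pvar_le.
- move=> f g Af Ag.
  have f0 := uniform_norm_ge0 alpha_gt0 Af.
  have g0 := uniform_norm_ge0 alpha_gt0 Ag.
  have Vf0 := fine_variation_ge0 alpha_gt0 Af.
  have Vg0 := fine_variation_ge0 alpha_gt0 Ag.
  apply: (@le_trans _ _ (uniform_norm f * uniform_norm g +
      (uniform_norm g * fine (weighted_variation alpha f) +
       uniform_norm f * fine (weighted_variation alpha g)))).
    apply: (A_norm_le alpha_gt0) => [|n|n].
    + exact: A_M.
    + by rewrite /= Normc.normcM ler_pM ?normc_ge0 ?A_normc_le.
    + rewrite (le_trans (partial_variationM alpha_gt0 n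
        (fun i => A_normc_le (Some i) Af) (fun i => A_normc_le (Some i) Ag)))//.
      by rewrite lerD// ler_wpM2l// A_pvar_le.
  rewrite /A_norm; have := mulr_ge0 Vf0 Vg0; lra.
Qed.

Lemma partial_variation_small f n (e : R) :
  (forall i, normc (f (Some i)) <= e) ->
  partial_variation alpha f n <= (\sum_(0 <= i < n) alpha i *+ 2) * e.
Proof.
move=> fe; rewrite mulr_suml ler_sum// => i _.
rewrite /variation_term mulrnAl -mulrnAr ler_wpM2l ?(ltW (alpha_gt0 _))// mulr2n.
by rewrite (le_trans (normcD _ _))// lerD// normc_opp.
Qed.

(** A pointwise limit of a Cauchy sequence is a limit in norm: each partial
    variation involves finitely many points, so it passes to the limit, and the
    bound that the Cauchy condition gives for it does not depend on its
    length. *)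
Lemma A_complete : complete_norm (A_ alpha) (A_norm alpha).
Proof.
move=> u Au cu.
have AuB m n : A_ alpha (u m \- u n) by exact: A_B.
have /choice[f fP] : forall x, exists l, forall e : R, 0 < e ->
    exists n0 : nat, forall n : nat, (n0 <= n)%N -> normc (u n x - l) < e.
  move=> x; apply: cauchy_normc_cvg => e /cu[n0 un0]; exists n0 => m n mn0 nn0.
  exact: le_lt_trans (normc_le_A_norm alpha_gt0 x (AuB m n)) (un0 _ _ mn0 nn0).
(* In this step and the next, the index [n] of an auxiliary term is sent to
   infinity in the Cauchy estimate for [u m \- u n]. *)
have unif e : 0 < e -> exists n0 : nat, forall m, (n0 <= m)%N ->
    forall x, normc (u m x - f x) <= e.
  move=> e0; have [n0 un0] := cu _ e0; exists n0 => m n0m x.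
  apply/ler_addgt0Pr => d d0; have [n1 fn1] := fP x _ d0.
  pose n := maxn n0 n1.
  rewrite (le_trans (normc_dist3 (u n x) _ _))// lerD//; apply: ltW.
    apply: le_lt_trans (normc_le_A_norm alpha_gt0 x (AuB m n)) _.
    by rewrite un0// leq_maxl.
  by rewrite fn1// leq_maxr.
have pvar e : 0 < e -> exists n0 : nat, forall m, (n0 <= m)%N ->
    forall k, partial_variation alpha (u m \- f) k <= e.
  move=> e0; have [n0 un0] := cu _ e0; exists n0 => m n0m k.
  apply/ler_addgt0Pr => d d0.
  pose S := \sum_(0 <= i < k) alpha i *+ 2.
  have S0 : 0 <= S by rewrite sumr_ge0// => i _; rewrite mulrn_wge0 ?ltW.
  have S1 : 0 < S + 1 by rewrite ltr_wpDl.
  have [n1 un1] := unif (d / (S + 1)) (divr_gt0 d0 S1).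
  pose n := maxn n0 n1.
  have -> : u m \- f = (u m \- u n) \+ (u n \- f).
    by apply/funext => x /=; rewrite addrA subrK.
  rewrite (le_trans (partial_variationD alpha_gt0 _ _ _))// lerD//.
    apply: le_trans (partial_variation_le_A_norm alpha_gt0 k (AuB m n)) _.
    by rewrite ltW// un0// leq_maxl.
  apply: le_trans (partial_variation_small k (fun i => un1 n (leq_maxr _ _) _)) _.
  by rewrite -/S mulrA ler_pdivrMr// mulrC ler_pM2l// lerDl.
have Af : A_ alpha f.
  apply/(A_P alpha_gt0); split.
    move=> e e0; have e3 : 0 < e / 3 by rewrite divr_gt0.
    have [m um] := unif _ e3.
    have /(A_P alpha_gt0)[/(_ _ e3)[N uN] _] := Au m.
    exists N => n Nn.
    have := normc_dist3 (u m (Some n)) (f (Some n)) (f None).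
    have := normc_dist3 (u m None) (u m (Some n)) (f None).
    rewrite (normcC (f _) (u m _)).
    have := um m (leqnn m) (Some n); have := um m (leqnn m) None.
    have := uN _ Nn; lra.
  have [m um] := pvar 1 ltr01.
  have /(A_P alpha_gt0)[_ [K uK]] := Au m.
  exists (K + 1) => k.
  have -> : f = u m \+ (-1 \*o (u m \- f)).
    by apply/funext => x /=; ring.
  rewrite (le_trans (partial_variationD alpha_gt0 _ _ _))//.
  by rewrite partial_variationZ normc_opp Normc.normc1 mul1r lerD// um.
exists f => //; apply/cvgrPdist_le => e e0.
have e2 : 0 < e / 2 by rewrite divr_gt0.
have [n0 un0] := unif _ e2; have [n1 vn1] := pvar _ e2.
exists (maxn n0 n1) => // n /=; rewrite geq_max => /andP[n0n n1n].
have AB : A_ alpha (u n \- f) by exact: A_B.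
rewrite sub0r normrN ger0_norm ?A_norm_ge0// [e]splitr.
by apply: (A_norm_le alpha_gt0) => // k; [exact: un0|exact: vn1].
Qed.

Definition ind (S : pred N_oo) : N_oo -> R[i] := fun x => (S x)%:R.

Definition head (N : nat) : pred N_oo :=
  fun x => if x is Some n then (n < N)%N else false.

Lemma A_ind_point n : A_ alpha (ind (pred1 (Some n))).
Proof.
apply: (@A_eventually_cst _ _ alpha_gt0 _ n.+1) => m nm.
by rewrite /ind /= (inj_eq Some_inj) gtn_eqF.
Qed.

Lemma A_ind_predC1 n : A_ alpha (ind (predC1 (Some n))).
Proof.
apply: (@A_eventually_cst _ _ alpha_gt0 _ n.+1) => m nm.
by rewrite /ind /= (inj_eq Some_inj) gtn_eqF.
Qed.

Lemma A_ind_head N : A_ alpha (ind (head N)).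
Proof.
by apply: (@A_eventually_cst _ _ alpha_gt0 _ N) => m; rewrite /ind /= ltnNge => ->.
Qed.

Lemma ind_predC1_mul n f : f (Some n) = 0 ->
  ind (predC1 (Some n)) \* f = f.
Proof.
by move=> fn; apply/funext => x; rewrite /ind /=; case: eqP => [->|_];
  rewrite ?fn ?mulr0 ?mul1r.
Qed.

Lemma A_banach_function_algebra :
  banach_function_algebra (A_ alpha) (A_norm alpha).
Proof.
split.
- split; [exact: one_point_compactification_compact|exact: N_oo_hausdorff].
- by move=> f [].
- split; [exact: A_cst|exact: A_D|exact: A_Z|exact: A_M].
- have sep n (x : N_oo) : x <> Some n ->
      ind (pred1 (Some n)) (Some n) <> ind (pred1 (Some n)) x.
    by move=> /eqP xn; rewrite /ind /= eqxx (negbTE xn); exact/eqP/oner_neq0.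
  move=> x [n|] xy.
    by exists (ind (pred1 (Some n))); [exact: A_ind_point|exact: nesym (sep _ _ xy)].
  by case: x xy => [n|//] xy; exists (ind (pred1 (Some n)));
    [exact: A_ind_point|exact: sep _ _ (nesym xy)].
- split; [exact: A_algebra_norm|exact: A_complete].
Qed.

End BanachAlgebra.

(** * Cutting off at indices of small weight *)

Section Approximation.
Context {R : realType}.
Variable alpha : nat -> R.
Hypothesis alpha_gt0 : forall n, 0 < alpha n.
Implicit Types f : N_oo -> R[i].

Lemma A_norm0 f : f = cst 0 -> A_norm alpha f = 0.
Proof.
move=> ->; have [_ _ NZ _ _] := A_algebra_norm alpha_gt0.
have := NZ 0 (cst 0) (A_cst alpha_gt0 0); rewrite Normc.normc0 mul0r => <-.
by congr (A_norm alpha); apply/funext => x /=; rewrite mulr0.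
Qed.

Lemma partial_variation_cut f N n :
  (forall i, (i < N)%N -> f (Some i.+1) = f (Some i)) ->
  partial_variation alpha f n <=
    variation_term alpha f N +
    \sum_(N.+1 <= i < n) variation_term alpha f i.
Proof.
move=> fN; have term0 := variation_term_ge0 alpha_gt0 f.
have fN0 i : (i < N)%N -> variation_term alpha f i = 0.
  by move=> /fN fi; rewrite /variation_term fi subrr Normc.normc0 mulr0.
have [nN|Nn] := leqP n N.
  rewrite /partial_variation big_nat big1 ?addr_ge0 ?sumr_ge0// => i /andP[_ ni].
  exact/fN0/(leq_trans ni).
have low0 : partial_variation alpha f N = 0.
  by rewrite /partial_variation big_nat big1// => i /andP[_ iN]; exact: fN0.
rewrite /partial_variation (big_cat_nat (leq0n N) (ltnW Nn))/=.
by rewrite -/(partial_variation alpha f N) low0 add0r big_ltn.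
Qed.

Lemma variation_tail_small f (e : R) : A_ alpha f -> 0 < e ->
  exists N0 : nat, forall N n, (N0 <= N)%N ->
    \sum_(N <= i < n) variation_term alpha f i <= e.
Proof.
move=> Af e0; have term0 := variation_term_ge0 alpha_gt0 f.
pose V := range (partial_variation alpha f).
have hasV : has_sup V.
  split; first by exists (partial_variation alpha f 0), 0%N.
  exists (A_norm alpha f) => _ [n _ <-].
  exact: partial_variation_le_A_norm.
have [_ [N0 _ <-] supN0] := sup_adherent e0 hasV.
exists N0 => N n N0N; have [nN|/ltnW Nn] := leqP n N.
  by rewrite big_geq// ltW.
have : partial_variation alpha f n <= sup V.
  by apply: ub_le_sup; [case: hasV|exists n].
rewrite /partial_variation (big_cat_nat (leq0n N) Nn)/=.
rewrite (big_cat_nat (leq0n N0) N0N)/= -/(partial_variation alpha f N0).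
have : 0 <= \sum_(N0 <= i < N) variation_term alpha f i by rewrite sumr_ge0.
move: supN0; lra.
Qed.

(** Cutting [f] off after [N] costs the tail of its variation, its size beyond
    [N], and the single jump [alpha N * |f N.+1|], which is small as long as
    [N] runs through indices where [alpha] stays bounded. *)
Lemma A_norm_head_approx f (M e : R) : A_ alpha f -> f None = 0 -> 0 < M -> 0 < e ->
  exists N0 : nat, forall N, (N0 <= N)%N -> alpha N <= M ->
    A_norm alpha ((ind (head N.+1) \* f) \- f) < e.
Proof.
move=> Af f0 M0 e0.
have M3 : 0 < M + 3 by lra.
pose d := e / (M + 3).
have d0 : 0 < d by rewrite divr_gt0.
have [N1 fN1] := variation_tail_small Af d0.
have /(A_P alpha_gt0)[/(_ _ d0)[N2 fN2] _] := Af.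
exists (maxn N1 N2) => N; rewrite geq_max => /andP[N1N N2N] aN.
set h := _ \- f.
have hlow i : (i <= N)%N -> h (Some i) = 0.
  by move=> iN; rewrite /h /ind /= ltnS iN mul1r subrr.
have hhigh i : (N < i)%N -> h (Some i) = - f (Some i).
  by move=> iN; rewrite /h /ind /= ltnS leqNgt iN mul0r sub0r.
have fd i : (N <= i)%N -> normc (f (Some i)) <= d.
  by move=> Ni; have := fN2 i (leq_trans N2N Ni); rewrite f0 subr0 => /ltW.
have Ah : A_ alpha h by apply: A_B => //; apply: A_M => //; exact: A_ind_head.
clearbody h.
(* The summands bound the sup norm, the jump at [N] and the tail; [d] is chosen
   as [e / (M + 3)] to make the inequality strict. *)
apply: (@le_lt_trans _ _ (d + (M * d + d))); last first.
  rewrite (_ : e = (M + 3) * d); last by rewrite /d mulrC divfK// gt_eqF.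
  move: d0; clear; nra.
apply: (A_norm_le alpha_gt0) => // n.
  have [nN|Nn] := leqP n N; first by rewrite hlow// Normc.normc0 ltW.
  by rewrite hhigh// normc_opp fd// ltnW.
apply: le_trans (partial_variation_cut _ (N := N) _) _.
  by move=> i iN; rewrite !hlow// ltnW.
rewrite lerD//.
  rewrite /variation_term (hlow N)// hhigh// subr0 normc_opp.
  by rewrite ler_pM ?(ltW (alpha_gt0 _)) ?normc_ge0 ?fd.
apply: le_trans (fN1 N.+1 n (leqW N1N)); rewrite big_nat [leRHS]big_nat.
apply: ler_sum => i /andP[Ni _].
by rewrite /variation_term (hhigh i)// hhigh 1?ltnW// -opprD normc_opp.
Qed.

(** The only jump of the indicator is the one from [N] to [N.+1]. *)
Lemma A_norm_head_le N : A_norm alpha (ind (head N.+1)) <= 1 + alpha N.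
Proof.
apply: (A_norm_le alpha_gt0) => [|n|n]; first exact: A_ind_head.
  by rewrite /ind; case: head; rewrite ?Normc.normc0 ?Normc.normc1.
apply: le_trans (partial_variation_cut _ (N := N) _) _.
  by move=> i iN; rewrite /ind /= !ltnS iN ltnW.
rewrite big_nat big1 ?addr0 => [|i /andP[Ni _]]; last first.
  rewrite /variation_term /ind /= !ltnS (leqNgt i) Ni (ltnNge i) (ltnW Ni).
  by rewrite subrr Normc.normc0 mulr0.
rewrite /variation_term /ind /= ltnn ltnSn sub0r normc_opp Normc.normc1 mulr1//.
Qed.

End Approximation.

(** * Characters and idempotents *)

Section Characters.
Context {R : realType}.
Variable alpha : nat -> R.
Hypothesis alpha_gt0 : forall n, 0 < alpha n.
Implicit Types (phi psi : {ptws A_ alpha -> R[i]^o}).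

Definition elt f (Af : A_ alpha f) : A_ alpha := exist _ f (mem_set Af).

Definition evaluation (x : N_oo) : {ptws A_ alpha -> R[i]^o} := fun f => val f x.

Lemma evaluation_character x : character_space (evaluation x).
Proof.
split.
- by move=> a b f g h hfg; rewrite /evaluation hfg.
- by move=> f g h hfg; rewrite /evaluation hfg.
- exists (elt (A_cst alpha_gt0 1)); exact/eqP/oner_neq0.
Qed.

Lemma characterD phi (f g h : A_ alpha) : character_space phi ->
  val h = val f \+ val g -> phi h = phi f + phi g.
Proof.
move=> [lin _ _] hfg; rewrite (lin 1 1 f g h) ?mul1r// hfg.
by apply/funext => x /=; rewrite !mul1r.
Qed.

Lemma characterM phi (f g h : A_ alpha) : character_space phi ->
  val h = val f \* val g -> phi h = phi f * phi g.
Proof. by move=> [_ mul _]; exact: mul. Qed.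

Lemma character0 phi (f : A_ alpha) : character_space phi ->
  val f = cst 0 -> phi f = 0.
Proof.
move=> [lin _ _] f0; rewrite (lin 0 0 f f f) ?mul0r ?addr0// f0.
by apply/funext => x /=; rewrite mul0r addr0.
Qed.

Lemma character1 phi (f : A_ alpha) : character_space phi ->
  val f = cst 1 -> phi f = 1.
Proof.
move=> cphi f1; have [_ _ [g /eqP g0]] := cphi.
apply: (mulIf g0); rewrite mul1r; apply/esym/characterM => //.
by rewrite f1; apply/funext => x /=; rewrite mul1r.
Qed.

Lemma character_idempotent phi (p : A_ alpha) : character_space phi ->
  val p \* val p = val p -> phi p = 0 \/ phi p = 1.
Proof.
move=> cphi pp; have := characterM cphi (esym pp).
have [->|p0 pE] := eqVneq (phi p) 0; [by left|right].
by apply: (mulfI p0); rewrite -pE mulr1.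
Qed.

Lemma ind_idempotent (S : pred N_oo) : ind S \* ind S = ind S :> (_ -> R[i]).
Proof. by apply/funext => x /=; rewrite /ind; case: (S x); rewrite ?mulr1 ?mulr0. Qed.

(** A character takes only the values [0] and [1] at an idempotent, so it
    kills [p], and with it [p \* f], as soon as it is near [phi] at [p]. *)
Lemma J_idempotent phi (p f : A_ alpha) :
  phi p = 0 -> val p \* val p = val p -> val p \* val f = val f -> J_ phi f.
Proof.
move=> phip pp pf; rewrite /J_ /within /=.
have evp : (fun psi : {ptws A_ alpha -> R[i]^o} => psi p) @ phi --> phi p.
  exact: (@proj_continuous _ (fun=> R[i]^o) p phi).
have /(cvg_normcP (nbhs_filter _))/(_ _ ltr01) := evp.
apply: filterS => psi; rewrite phip sub0r normc_opp => psip cpsi.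
rewrite (characterM cpsi (esym pf)).
have [->|psi1] := character_idempotent cpsi pp; first by rewrite mul0r.
by move: psip; rewrite psi1 Normc.normc1 ltxx.
Qed.

End Characters.

(** * Maximal ideals and characters are points *)

Section Ideals.
Context {R : realType}.
Variable alpha : nat -> R.
Hypothesis alpha_gt0 : forall n, 0 < alpha n.

(** An ideal without common zero contains a function that is [1] on an initial
    segment and, beyond it, agrees with a member that is nonzero at infinity.
    Such a function is invertible when the segment is long enough. *)
Lemma proper_ideal_common_zero (I : set (N_oo -> R[i])) :
  ideal (A_ alpha) I -> I <> A_ alpha -> exists x, forall f, I f -> f x = 0.
Proof.
move=> [IA I0 ID IM] InA; apply: contrapT => nozero.
have I_nz x : exists2 f, I f & f x != 0.
  apply: contrapT => nx; apply: nozero; exists x => f If.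
  by apply: contrapT => /eqP fx; apply: nx; exists f.
have I_point n : I (ind (pred1 (Some n))).
  have [f If fn] := I_nz (Some n).
  have -> : ind (pred1 (Some n)) = ((f (Some n))^-1 \*o ind (pred1 (Some n))) \* f.
    apply/funext => x; rewrite /ind /=; case: eqP => [->|_].
      by rewrite mulr1 mulVf.
    by rewrite mulr0 mul0r.
  by apply: IM => //; apply: A_Z => //; exact: A_ind_point.
have I_head N : I (ind (head N)).
  elim: N => [|N IN].
    by rewrite (_ : ind (head 0) = cst 0)//; apply/funext => -[].
  have -> : ind (head N.+1) = ind (head N) \+ ind (pred1 (Some N)) :> (_ -> R[i]).
    apply/funext => -[n|]; rewrite /ind /= ?addr0//.
    by rewrite ltnS leq_eqVlt (inj_eq Some_inj); case: ltngtP; rewrite ?addr0 ?add0r.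
  exact: ID.
have [f If f0] := I_nz None.
have d0 : 0 < normc (f None) / 2.
  by rewrite divr_gt0// lt_def normc_eq0 f0 normc_ge0.
have /(A_P alpha_gt0)[/(_ _ d0)[N fN] _] := IA _ If.
pose h := ind (head N) \+ ((cst 1 \- ind (head N)) \* f).
have Ih : I h.
  apply: ID => //; apply: IM => //.
  by apply: A_B => //; [exact: A_cst|exact: A_ind_head].
have hd x : Num.min 1 (normc (f None) / 2) <= normc (h x).
  rewrite ge_min /h /ind /=; case: x => [n|] /=.
    have [Nn|nN] := leqP N n; last by rewrite subrr mul0r addr0 Normc.normc1 lexx.
    rewrite subr0 mul1r add0r.
    have := fN _ Nn; have := normcD (f (Some n)) (f None - f (Some n)).
    rewrite addrCA subrr addr0 (normcC (f None)) => h1 h2; apply/orP; right.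
    move: h1 h2; lra.
  by rewrite subr0 mul1r add0r; apply/orP; right; move: d0; lra.
have m0 : 0 < Num.min 1 (normc (f None) / 2) by rewrite lt_min ltr01.
have I1 : I (cst 1).
  have -> : cst 1 = (fun x => (h x)^-1) \* h.
    apply/funext => x /=; rewrite mulVf// -normc_eq0 gt_eqF//.
    exact: lt_le_trans m0 (hd x).
  by apply: IM => //; apply: (A_V alpha_gt0 m0 hd); exact: IA.
apply: InA; apply/seteqP; split=> // g Ag.
by rewrite (_ : g = g \* cst 1); [exact: IM|apply/funext => x /=; rewrite mulr1].
Qed.

Lemma maximal_idealE (I : set (N_oo -> R[i])) :
  maximal_ideal (A_ alpha) I ->
  exists x, I = [set f | A_ alpha f /\ f x = 0].
Proof.
move=> [idI InA Imax]; have [x Ix] := proper_ideal_common_zero idI InA.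
exists x; set K := [set f | _].
have idK : ideal (A_ alpha) K.
  split=> [f []//||f g [Af fx] [Ag gx]|f g Af [Ag gx]].
  - by split=> //; exact: A_cst.
  - by split; [exact: A_D|rewrite /= fx gx addr0].
  - by split; [exact: A_M|rewrite /= gx mulr0].
have IK : I `<=` K.
  by move=> f If; split; [case: idI => + _ _ _; apply|exact: Ix].
have [->//|KA] := Imax K idK IK.
have [_ /eqP] : K (cst 1) by rewrite KA; exact: A_cst.
by rewrite oner_eq0.
Qed.

(** The kernel is a proper ideal, so it has a common zero [x]; since it contains
    [f - phi f] for every [f], the value of [f] at [x] is [phi f]. *)
Lemma characterE (phi : {ptws A_ alpha -> R[i]^o}) : character_space phi ->
  exists x, forall f : A_ alpha, phi f = val f x.
Proof.
move=> cphi; pose I := [set f | exists Af : A_ alpha f, phi (elt Af) = 0].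
have idI : ideal (A_ alpha) I.
  split=> [f []//||f g [Af fI] [Ag gI]|f g Af [Ag gI]].
  - by exists (A_cst alpha_gt0 0); exact: character0.
  - exists (A_D alpha_gt0 Af Ag).
    by rewrite (characterD (f := elt Af) (g := elt Ag) cphi)// fI gI addr0.
  - exists (A_M alpha_gt0 Af Ag).
    by rewrite (characterM (f := elt Af) (g := elt Ag) cphi)// gI mulr0.
have InA : I <> A_ alpha.
  move=> IA; have [A1] : I (cst 1) by rewrite IA; exact: A_cst.
  by rewrite character1//; apply/eqP/oner_neq0.
have [x Ix] := proper_ideal_common_zero idI InA.
exists x => f; have Af : A_ alpha (val f) by exact/set_mem/valP.
have Ac := A_cst alpha_gt0 (- phi f).
have A1 := A_cst alpha_gt0 1.
have [lin _ _] := cphi.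
have /Ix /= : I (val f \+ cst (- phi f)).
  exists (A_D alpha_gt0 Af Ac).
  rewrite (lin 1 (- phi f) f (elt A1)).
    by rewrite mul1r (character1 (f := elt A1))// mulr1 subrr.
  by apply/funext => y /=; rewrite mul1r mulr1.
by move=> /eqP; rewrite subr_eq0 => /eqP.
Qed.

End Ideals.

(** * Strong regularity, approximate identities and relative units *)

Section StrongDitkin.
Context {R : realType}.
Variable alpha : nat -> R.
Hypothesis alpha_gt0 : forall n, 0 < alpha n.

Lemma bounded_subsequence : ~ (alpha n @[n --> \oo] --> +oo) ->
  exists2 M, 0 < M & forall N0 : nat, exists2 N : nat, (N0 <= N)%N & alpha N <= M.
Proof.
move=> ndvg; apply: contrapT => nM; apply: ndvg; apply/cvgryPge => B.
apply: contrapT => nB; apply: nM; exists (Num.max 1 B).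
  by rewrite lt_max ltr01.
move=> N0; apply: contrapT => nN; apply: nB; exists N0 => // N /= N0N.
rewrite leNgt; apply/negP => aB; apply: nN; exists N => //.
by rewrite le_max (ltW aB) orbT.
Qed.

(** Take [phi] to be evaluation at [m], and [E] to consist of evaluation at
    [m.+1] alone. *)
Lemma bounded_relative_units_le (C : R) :
  (forall phi, @character_space _ _ (A_ alpha) phi ->
    forall E : set {ptws A_ alpha -> R[i]^o},
      compact E -> E `<=` @character_space _ _ (A_ alpha) `\ phi ->
      exists f : A_ alpha, [/\ J_ phi f, A_norm alpha (val f) <= C &
                        forall psi, E psi -> psi f = 1]) ->
  forall m, alpha m <= C.
Proof.
move=> bru m; pose phi : {ptws A_ alpha -> R[i]^o} := evaluation (Some m).
pose psi : {ptws A_ alpha -> R[i]^o} := evaluation (Some m.+1).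
have cphi : character_space phi by exact: evaluation_character.
have [||f [Jf fC fE]] := bru phi cphi [set psi].
- exact: compact_set1.
- move=> _ ->; split; first exact: evaluation_character.
  move=> /(congr1 (@^~ (elt (A_ind_point alpha_gt0 m)))).
  rewrite /phi /psi /evaluation /= /ind /= (inj_eq Some_inj) eqxx gtn_eqF//.
  by move=> /esym/eqP; rewrite oner_eq0.
have Af : A_ alpha (val f) by exact/set_mem/valP.
have f0 : val f (Some m) = 0 by exact: (nbhs_singleton Jf cphi).
have f1 : val f (Some m.+1) = 1 by exact: (fE psi).
apply: le_trans fC; apply: le_trans (variation_term_le_A_norm alpha_gt0 m Af).
by rewrite /variation_term f1 f0 subr0 Normc.normc1 mulr1.
Qed.

Variable M : R.
Hypothesis M_gt0 : 0 < M.
Hypothesis alpha_M : forall N0 : nat, exists2 N : nat, (N0 <= N)%N & alpha N <= M.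

(** For a finite point [J_] is all of [M_], by the idempotent that is [0] at this
    point only; at infinity the approximants are the cut-offs. *)
Lemma A_strongly_regular : strongly_regular (A_ alpha) (A_norm alpha).
Proof.
move=> phi cphi f phif e e0.
have [x phiE] := characterE alpha_gt0 cphi.
have Af : A_ alpha (val f) by exact/set_mem/valP.
have fx : val f x = 0 by rewrite -phiE.
case: x phiE fx => [n|] phiE fx.
  exists f.
    apply: (J_idempotent (p := elt (A_ind_predC1 alpha_gt0 n))).
    - by rewrite phiE /= /ind /= eqxx.
    - exact: ind_idempotent.
    - exact: ind_predC1_mul.
  by rewrite A_norm0//; apply/funext => y /=; rewrite subrr.
have [N0 fN0] := A_norm_head_approx alpha_gt0 Af fx M_gt0 e0.
have [N N0N aN] := alpha_M N0.
pose p := ind (head N.+1) : N_oo -> R[i].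
have Ap : A_ alpha p by exact: A_ind_head.
exists (elt (A_M alpha_gt0 Ap Af)).
  apply: (J_idempotent (p := elt Ap)); first by rewrite phiE.
    exact: ind_idempotent.
  apply/funext => y /=; rewrite mulrA; congr (_ * _).
  exact: (congr1 (@^~ y) (ind_idempotent _)).
have [_ _ NZ _ _] := A_algebra_norm alpha_gt0.
have -> : val f \- (p \* val f) = -1 \*o ((p \* val f) \- val f).
  by apply/funext => y /=; ring.
rewrite NZ; first by rewrite normc_opp Normc.normc1 mul1r fN0.
by apply: A_B => //; exact: A_M.
Qed.

Lemma A_bounded_approximate_identity (I : set (N_oo -> R[i])) :
  maximal_ideal (A_ alpha) I ->
  has_bounded_approximate_identity (A_norm alpha) I.
Proof.
move=> /(maximal_idealE alpha_gt0)[[n|] ->].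
  exists unit, (fun _ _ => True), (fun=> ind (predC1 (Some n))); split.
  - by split.
  - by move=> _; split; [exact: A_ind_predC1|rewrite /ind /= eqxx].
  - by exists (A_norm alpha (ind (predC1 (Some n)))).
  - move=> f [Af fn] e e0; exists tt => _ _; rewrite ind_predC1_mul//.
    by rewrite A_norm0//; apply/funext => y /=; rewrite subrr.
have /choice[s sP] : forall k, exists N : nat, (k <= N)%N /\ alpha N <= M.
  by move=> k; have [N kN aN] := alpha_M k; exists N.
exists nat, (fun m n => m <= n)%N, (fun k => ind (head (s k).+1)); split.
- split; [exact: (inhabits 0%N)|exact: leqnn|by move=> x y z; exact: leq_trans|].
  move=> x y.
  by exists (maxn x y); rewrite leq_maxl leq_maxr.
- by move=> k; split=> //; exact: A_ind_head.
- exists (1 + M) => k; apply: le_trans (A_norm_head_le alpha_gt0 _) _.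
  by rewrite lerD2l; case: (sP k).
- move=> f [Af f0] e e0.
  have [N0 fN0] := A_norm_head_approx alpha_gt0 Af f0 M_gt0 e0.
  exists N0 => k N0k; have [ksk ask] := sP k.
  by apply: fN0 => //; exact: leq_trans ksk.
Qed.

End StrongDitkin.

Theorem corollary2p7 (R : realType) (alpha : nat -> R)
    (alpha_gt0 : forall n, 0 < alpha n)
    (alpha_unbounded : ~ bounded_fun alpha)
    (alpha_ndvg : ~ (alpha n @[n --> \oo] --> +oo)) :
  strong_Ditkin_algebra (A_ alpha) (A_norm alpha) /\
  ~ bounded_relative_units (A_ alpha) (A_norm alpha).
Proof.
split.
  have [M M0 aM] := bounded_subsequence alpha_ndvg.
  split.
  - exact: A_banach_function_algebra.
  - exact: A_strongly_regular M0 aM.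
  - exact: A_bounded_approximate_identity M0 aM.
move=> [C _ bru]; apply: alpha_unbounded.
have aC := bounded_relative_units_le alpha_gt0 bru.
exists C; split; first exact: num_real.
by move=> K CK n _ /=; rewrite ger0_norm ?ltW// (le_lt_trans (aC n)).
Qed.
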